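(* Let $k,n\in\mathbb{N}$ satisfy $\gcd(k,n)=1$. Then the function $f:\mathbb{F}_{2^n}\to\mathbb{F}_{2^n}$ given by $f(x)=x^{2^{2k}+2^k+1}$ has optimal second-order differential uniformity, i.e. $\delta^2(f)=4$.
   Context: $\mathbb{N}=\{1,2,3,\dots\}$; $\mathbb{F}_{2^n}$ is the finite field with $2^n$ elements and $\mathbb{F}_{2^n}^*$ its set of non-zero elements. For $f:\mathbb{F}_{2^n}\to\mathbb{F}_{2^n}$ and $a\in\mathbb{F}_{2^n}^*$, the discrete derivative is $D_af(x)=f(x+a)-f(x)$, and $D^{(2)}_{a,b}f=D_aD_bf$, i.e. $D^{(2)}_{a,b}f(x)=f(x)+f(x+a)+f(x+b)+f(x+a+b)$. The second-order differential uniformity of $f$ is $$\delta^2(f)=\max_{a,b\in\mathbb{F}_{2^n}^*,\ a\neq b,\ c\in\mathbb{F}_{2^n}}\left|\{x\in\mathbb{F}_{2^n} : D^{(2)}_{a,b}f(x)=c\}\right|.$$ The function $f$ is said to have optimal second-order differential uniformity if $\delta^2(f)=4$.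
   Formalization: The formal statement assumes n ≥ 2: for n = 1 the field F_2 has no two distinct non-zero elements a, b, so the maximum defining δ²(f) is over an empty set and δ²(f) = 4 cannot hold. *)

(* Defs.v *)
From mathcomp Require Import all_boot all_algebra.

Set Implicit Arguments.
Unset Strict Implicit.
Unset Printing Implicit Defensive.

Import GRing.Theory.
Local Open Scope ring_scope.

Definition derivative (V : zmodType) (a : V) (f : V -> V) : V -> V :=
  fun x => f (x + a) - f x.

Definition derivative2 (V : zmodType) (a b : V) (f : V -> V) : V -> V :=
  derivative a (derivative b f).

(* If F has only one non-zero element, there is no pair (a, b) to range over
   and this maximum takes the default value 0. *)
Definition second_order_diff_uniformity (F : finFieldType) (f : F -> F) : nat :=
  \max_(abc : F * F * F |
          [&& abc.1.1 != 0, abc.1.2 != 0 & abc.1.1 != abc.1.2])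
    #|[set x : F | derivative2 abc.1.1 abc.1.2 f x == abc.2]|.

Definition optimal_second_order (F : finFieldType) (f : F -> F) : Prop :=
  second_order_diff_uniformity f = 4%N.

(* Main.v *)
Require Import Defs.
From mathcomp Require Import all_boot all_algebra.
From mathcomp Require Import finfield ring.

(* Write s x = x^(2^k).  Since f x = x * s x * s (s x) is the diagonal of a form
   that is trilinear over F_2, D_{a,b} f is affine, and its linear part is the
   permanent of the matrix with rows (u, s u, s (s u)), u = a, b, x.  In
   characteristic 2 this is the Moore determinant of a, b, x, which vanishes
   exactly when a, b, x are linearly dependent over the fixed field of s, and
   that field is F_2 because gcd(k, n) = 1.  So every non-empty fibre of
   D_{a,b} f is a coset of {0, a, b, a + b}. *)

Set Implicit Arguments.
Unset Strict Implicit.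
Unset Printing Implicit Defensive.

Import GRing.Theory.
Local Open Scope ring_scope.

(** Signs are kept, although the application has characteristic 2, so that the vanishing criterion
    below holds over any field. *)
Definition moore_det3 (F : fieldType) (s : F -> F) (a b x : F) : F :=
  a * (s b * s (s x) - s (s b) * s x) - s a * (b * s (s x) - s (s b) * x)
  + s (s a) * (b * s x - s b * x).

(* Dividing by a turns the equation into w * s z = s w * z with
   w = s (b / a) - b / a and z = s (x / a) - x / a, so z / w is fixed by s. *)
Lemma moore_det3_eq0 (F : fieldType) (s : {rmorphism F -> F}) (a b x : F) :
    a != 0 -> s (b / a) != b / a -> moore_det3 s a b x = 0 ->
  exists c d, [/\ s c = c, s d = d & x = c * a + d * b].
Proof.
move=> a0 fixba det0; set t := b / a in fixba; pose y := x / a.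
have bE : b = a * t by rewrite /t mulrC divfK.
have xE : x = a * y by rewrite /y mulrC divfK.
pose w := s t - t; pose z := s y - y.
have w0 : w != 0 by rewrite subr_eq0.
have sa0 : s a != 0 by rewrite fmorph_eq0.
have wz : w * s z = s w * z.
  (* With [b = a * t] and [x = a * y], the columns release [a], [s a], [s (s a)]. The row of [a]
     becomes (1, 1, 1), and column differences leave a 2 by 2 determinant. *)
  have e : a * s a * s (s a) * (w * s z - s w * z) = 0.
    rewrite -det0 /moore_det3 bE xE /w /z !rmorphB !rmorphM /=; ring.
  by apply/subr0_eq/eqP; move/eqP: e; rewrite !mulf_eq0 !fmorph_eq0 !(negPf a0).
pose d := z / w.
have sd : s d = d.
  apply/eqP; rewrite /d fmorph_div eqr_div ?fmorph_eq0 //.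
  by rewrite mulrC wz mulrC.
exists (y - d * t), d; split=> //; last by rewrite bE xE; ring.
have zE : z = d * w by rewrite divfK.
rewrite rmorphB (rmorphM s d) sd; apply/eqP; rewrite -subr_eq0; apply/eqP.
by transitivity (z - d * w); [rewrite /z /w; ring | rewrite zE subrr].
Qed.

Lemma pFrobenius_iter (R : comNzRingType) (p k : nat) :
  p \in [pchar R] -> exists s : {rmorphism R -> R}, forall x, s x = x ^+ (p ^ k).
Proof.
move=> chRp; elim: k => [|k [s sE]]; first by exists idfun => x; rewrite expr1.
exists (pFrobenius_aut chRp \o s) => x /=.
by rewrite pFrobenius_autE sE -exprM -expnSr.
Qed.

Lemma expf_card_iter (F : finFieldType) (m : nat) (x : F) : x ^+ (#|F| ^ m) = x.
Proof. by elim: m => [|m IH]; rewrite ?expr1 // expnS exprM expf_card. Qed.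

(** Bezout gives [u * k = v * n + 1], and raising to the power [p ^ (v * n)] is the identity on
    [F]. *)
Lemma frobenius_fixed_coprime (F : finFieldType) (p k n : nat) (x : F) :
    (0 < k)%N -> #|F| = (p ^ n)%N -> coprime k n -> x ^+ (p ^ k) = x ->
  x ^+ p = x.
Proof.
move=> k0 cardF ckn xk.
have xku u : x ^+ (p ^ (k * u)) = x.
  by elim: u => [|u IH]; rewrite ?muln0 ?expr1 // mulnS expnD exprM xk IH.
case: (egcdnP n k0) => u v uv _.
rewrite -[RHS](xku u) mulnC uv (eqP ckn) expnD expn1 exprM mulnC expnM -cardF.
by rewrite expf_card_iter.
Qed.

Section SecondDerivative.

Variables (F : finFieldType) (s : {rmorphism F -> F}).
Hypothesis char2 : 2 \in [pchar F].
Hypothesis s_fix : forall x, s x = x -> x = 0 \/ x = 1.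

Let f x := x * s x * s (s x).

Lemma derivative2_sub_moore (a b x y : F) :
  derivative2 a b f x - derivative2 a b f y = moore_det3 s a b (x - y).
Proof.
have two0 : 2%:R = 0 :> F by apply: pcharf0.
pose u := x - y.
have xE : x = y + u by rewrite /u addrC subrK.
rewrite xE [y + u - y]addrAC subrr add0r.
(* The difference is the permanent: the determinant plus twice its three negative terms. *)
transitivity (moore_det3 s a b u + 2%:R * (a * s (s b) * s u +
   s a * b * s (s u) + s (s a) * s b * u)); last by rewrite two0 mul0r addr0.
rewrite /derivative2 /derivative /f /moore_det3 !rmorphD /=; ring.
Qed.

Lemma derivative2_fibre (a b x y : F) : a != 0 -> b != 0 -> a != b ->
  (derivative2 a b f x == derivative2 a b f y) =
  (x - y \in [:: 0; a; b; a + b]).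
Proof.
move=> a0 b0 ab; rewrite -subr_eq0 derivative2_sub_moore.
move: (x - y) => u; apply/eqP/idP => [|].
  case/moore_det3_eq0 => // [|c [d [/s_fix + /s_fix + ->]]].
    (* If [s] fixed [b / a], this quotient would be 0 or 1, that is [b = 0] or [b = a]. *)
    apply/eqP => /s_fix[] /eqP.
      by rewrite mulf_eq0 invr_eq0 (negPf a0) (negPf b0).
    by rewrite -subr_eq0 -(divff a0) -mulrBl mulf_eq0 invr_eq0 (negPf a0)
       orbF subr_eq0 eq_sym (negPf ab).
  by case=> -> [] ->; rewrite ?mul0r ?mul1r ?add0r ?addr0 !inE eqxx ?orbT.
rewrite !inE /moore_det3 => /or4P[] /eqP ->; rewrite ?rmorphD ?rmorph0 /=; ring.
Qed.

Lemma card_derivative2_fibre (a b y : F) : a != 0 -> b != 0 -> a != b ->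
  #|[set x | derivative2 a b f x == derivative2 a b f y]| = 4%N.
Proof.
move=> a0 b0 ab; pose r := [:: 0; a; b; a + b].
have -> : [set x | derivative2 a b f x == derivative2 a b f y]
          = [set y + u | u in r].
  apply/setP => x; rewrite inE derivative2_fibre //; apply/idP/imsetP.
    by move=> xy; exists (x - y); rewrite // addrC subrK.
  by case=> u ur ->; rewrite addrAC subrr add0r.
rewrite card_imset; last exact: addrI.
suff /card_uniqP -> : uniq r by [].
rewrite /= !inE !negb_or ![0 == _]eq_sym a0 b0 ab addr_eq0.
rewrite (oppr_pchar2 char2) ab.
rewrite -subr_eq0 opprD addNKr oppr_eq0 b0.
by rewrite -subr_eq0 opprD addrCA subrr addr0 oppr_eq0 a0.
Qed.

Lemma optimal_second_order_moore : (2 < #|F|)%N -> optimal_second_order f.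
Proof.
move=> F_gt2; apply/eqP; rewrite eqn_leq; apply/andP; split.
  apply/bigmax_leqP => -[[a b] c] /= /and3P[a0 b0 ab].
  case: (set_0Vmem [set x | derivative2 a b f x == c]) => [->|[y]].
    by rewrite cards0.
  by rewrite inE => /eqP <-; rewrite card_derivative2_fibre.
(* For the lower bound, any [b] outside {0, 1} makes (1, [b]) an admissible pair, and the fibre
   through 0 has four elements. *)
have [b b01] : exists b : F, b \notin [set 0; 1].
  apply/existsP; apply: contraLR F_gt2; rewrite negb_exists => /forallP F01.
  rewrite -leqNgt; apply: (@leq_trans #|[set 0; 1 : F]|).
    by apply/subset_leq_card/subsetP => x _; have := F01 x; rewrite negbK.
  by rewrite cards2 eq_sym oner_neq0.
move: b01; rewrite !inE negb_or => /andP[b0 b1].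
rewrite -(card_derivative2_fibre 0 (oner_neq0 F) b0); last by rewrite eq_sym.
by apply: (leq_bigmax_cond (1, b, derivative2 1 b f 0));
   rewrite /= oner_neq0 b0 eq_sym.
Qed.

End SecondDerivative.

Theorem theorem3p1 (k n : nat) (F : finFieldType)
    (k_gt0 : (0 < k)%N) (n_gt1 : (1 < n)%N) (cardF : #|F| = (2 ^ n)%N)
    (gcd_kn : gcdn k n = 1%N) :
  optimal_second_order (fun x : F => x ^+ (2 ^ (2 * k) + 2 ^ k + 1)).
Proof.
have char2 : 2 \in [pchar F] by apply: card_finPcharP cardF _.
have [s sE] := pFrobenius_iter k char2.
have s_fix x : s x = x -> x = 0 \/ x = 1.
  rewrite sE => /(frobenius_fixed_coprime k_gt0 cardF) -/(_ (introT eqP gcd_kn)).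
  move/eqP; rewrite expr2 -subr_eq0 -{3}[x]mulr1 -mulrBr mulf_eq0 subr_eq0.
  by case/orP=> /eqP; [left | right].
(* Here [n_gt1] enters: over the field with two elements no pair is admissible, and the maximum
   would be its default 0. *)
have F_gt2 : (2 < #|F|)%N.
  by rewrite cardF; apply: (@leq_trans (2 ^ 2)) => //; rewrite leq_exp2l.
have fE x : x * s x * s (s x) = x ^+ (2 ^ (2 * k) + 2 ^ k + 1).
  by rewrite !sE -exprM -expnD addnn -mul2n -exprS -exprD -addnA addn1 addnC.
have := optimal_second_order_moore char2 s_fix F_gt2.
rewrite /optimal_second_order => <-; apply: eq_bigr => abc _.
by apply: eq_card => x; rewrite !inE /derivative2 /derivative !fE.
Qed.
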